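(* Let $(x_1,\dots,x_n)$, $n\ge2$, be a family of points in some Euclidean vector space $E$, let $\gamma>0$, and consider the family of affine functions $\mathcal H=\{g_{w,b}:E\to\mathbb R;\ w\in E,\ \|w\|=1,\ b\in\mathbb R\}$, where $g_{w,b}(x)=\langle w,x\rangle-b$. Assume that there is a set of thresholds $(b_i)_{i=1}^n\in\mathbb R^n$ such that for any $(y_i)_{i=1}^n\in\{-1,+1\}^n$ there is $g_{w,b}\in\mathcal H$ such that $$\inf_{i=1,\dots,n}\bigl(g_{w,b}(x_i)-b_i\bigr)y_i\ge\gamma.$$ Let $\operatorname{Var}(x_1,\dots,x_n)=\frac1n\sum_{i=1}^n\bigl\|x_i-\frac1n\sum_{j=1}^nx_j\bigr\|^2$. Then $$\frac{\operatorname{Var}(x_1,\dots,x_n)}{\gamma^2}\ge\begin{cases}n-1&\text{when }n\text{ is even},\\(n-1)\frac{n^2-1}{n^2}&\text{when }n\text{ is odd}.\end{cases}$$ Moreover, equality is reached when $\gamma$ is optimal, $b_i=0$, $i=1,\dots,n$, and $(x_1,\dots,x_n)$ is a regular simplex, that is, when $\|x_i-x_j\|$ does not depend on $i\ne j$ and $2\gamma$ is the minimum distance between the convex hulls of any two disjoint non-empty subsets of $\{x_1,\dots,x_n\}$.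
   Context: A regular simplex is a family of distinct points with all pairwise distances $\|x_i-x_j\|$, $i\neq j$, equal. All other notions are standard. *)

(* Defs.v *)
From HB Require Import structures.
From mathcomp Require Import all_boot all_order all_algebra sesquilinear.
From mathcomp Require Import all_classical all_reals all_analysis.

Set Implicit Arguments.
Unset Strict Implicit.
Unset Printing Implicit Defensive.

Import Order.TTheory GRing.Theory Num.Theory.
Local Open Scope classical_set_scope.
Local Open Scope ring_scope.

(* A Euclidean vector space is a finite-dimensional real vector space
   [E : vectType R] together with a positive definite symmetric bilinear form
   [dot : {dot E for idfun}]. *)
Section Euclidean.
Context {R : realType} {E : vectType R} (dot : {dot E for idfun}).

Definition enorm (u : E) : R := Num.sqrt (dot u u).

Definition affine_function (w : E) (b : R) : E -> R := fun x => dot w x - b.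

Definition affine_family : set (E -> R) :=
  [set affine_function w b | w in [set w | enorm w = 1] & b in [set: R]].

Definition family_variance (n : nat) (x : 'I_n -> E) : R :=
  n%:R^-1 * \sum_(i < n) enorm (x i - n%:R^-1 *: \sum_(j < n) x j) ^+ 2.

Definition shattered (n : nat) (x : 'I_n -> E) (b : 'I_n -> R) (gamma : R) :=
  forall y : 'I_n -> R, (forall i, y i = -1 \/ y i = 1) ->
  exists2 g, affine_family g & gamma <= inf (range (fun i => (g (x i) - b i) * y i)).

Definition optimal_margin (n : nat) (x : 'I_n -> E) (b : 'I_n -> R) (gamma : R) :=
  shattered x b gamma /\
  forall gamma', shattered x b gamma' -> gamma' <= gamma.

Definition regular_simplex (n : nat) (x : 'I_n -> E) :=
  injective x /\
  forall i j k l, i != j -> k != l -> enorm (x i - x j) = enorm (x k - x l).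

Definition convex_hull (A : set E) : set E := smallest (@convex_set R E) A.

Definition set_distance (A B : set E) : R :=
  inf [set enorm (u - v) | u in A & v in B].

Definition hull_distances (n : nat) (x : 'I_n -> E) : set R :=
  [set d | exists A B : set E,
    [/\ A `<=` range x, B `<=` range x, A !=set0, B !=set0 & A `&` B = set0] /\
    d = set_distance (convex_hull A) (convex_hull B)].

Definition is_minimum (S : set R) (m : R) := S m /\ lbound S m.

End Euclidean.

Definition variance_bound (R : realType) (n : nat) : R :=
  if odd n then (n%:R - 1) * ((n%:R ^+ 2 - 1) / n%:R ^+ 2) else n%:R - 1.

(* Main.v *)
Require Import Defs.
From HB Require Import structures.
From mathcomp Require Import all_boot all_order all_algebra sesquilinear.
From mathcomp Require Import fingroup perm.
From mathcomp Require Import all_classical all_reals all_analysis.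
From mathcomp Require Import zify ring lra.

(* Shattering with margin gamma forces |sum_i l_i x_i| >= gamma * sum_i |l_i|
   for all weights l of zero sum, whatever the thresholds.  The average over
   permutations s of |sum_i l_i x_(s i)|^2 is n / (n - 1) * Var * sum_i l_i^2;
   taking for l the difference of the averages over the first half of the
   indices and over its complement gives the lower bound.
   For a regular simplex of squared side c, |sum_i l_i x_i|^2 is exactly
   c / 2 * sum_i l_i^2, so the distance between the centroids of complementary
   sets of points depends only on their sizes and is least for halves.  The
   direction joining these centroids separates the two sets by that distance,
   so half of the least distance is the optimal margin, and halfspaces show
   that no two hulls of disjoint subsets are closer. *)

Set Implicit Arguments.
Unset Strict Implicit.
Unset Printing Implicit Defensive.

Import Order.TTheory GRing.Theory Num.Theory.
Local Open Scope classical_set_scope.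
Local Open Scope ring_scope.

(** * Infima and sums over finite families *)

Lemma le_inf_range (R : realType) (n : nat) (f : 'I_n -> R) (a : R) :
  (0 < n)%N -> a <= inf (range f) <-> forall i, a <= f i.
Proof.
move=> n_gt0; split=> [a_le i|a_le].
  apply: (le_trans a_le); apply: ge_inf; last by exists i.
  (* Some lower bound is needed for [inf] to be a genuine infimum and not a default value. *)
  exists (- \sum_i `|f i|) => _ [j _ <-].
  rewrite lerNl (le_trans (ler_norm _))// normrN (bigD1 j)//= lerDl.
  exact: sumr_ge0.
apply: lb_le_inf; first by exists (f (Ordinal n_gt0)), (Ordinal n_gt0).
by move=> _ [i _ <-].
Qed.

Lemma sumr_delta (R : pzRingType) (I : finType) (f : I -> R) (i : I) :
  \sum_j f j * (i == j)%:R = f i.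
Proof.
rewrite (bigD1 i)//= eqxx mulr1 big1 ?addr0// => j /negbTE ji.
by rewrite eq_sym ji mulr0.
Qed.

Lemma sum_perm (V : nmodType) (T : finType) (s : {perm T}) (F : T -> V) :
  \sum_i F (s i) = \sum_i F i.
Proof. by rewrite [RHS](reindex_inj (@perm_inj _ s)). Qed.

(** * Weights opposing a set of indices to its complement *)

Section Contrast.
Context {R : realFieldType} {I : finType} (P : pred I).

(** As weights, these give the mean over [P] minus the mean over its complement, when neither is
    empty. *)
Definition contrast (i : I) : R :=
  if P i then #|P|%:R^-1 else - #|predC P|%:R^-1.

Lemma sum_contrast (f : bool -> R -> R) :
  \sum_i f (P i) (contrast i) =
    #|P|%:R * f true #|P|%:R^-1 + #|predC P|%:R * f false (- #|predC P|%:R^-1).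
Proof.
rewrite (bigID P)/=; congr (_ + _).
  rewrite (eq_bigr (fun=> f true #|P|%:R^-1)) => [|i Pi].
    by rewrite sumr_const mulr_natl.
  by rewrite /contrast Pi.
rewrite (eq_bigr (fun=> f false (- #|predC P|%:R^-1))) => [|i /negbTE Pi].
  by rewrite sumr_const mulr_natl.
by rewrite /contrast Pi.
Qed.

Hypotheses (P_gt0 : (0 < #|P|)%N) (PC_gt0 : (0 < #|predC P|)%N).

Let p_neq0 : #|P|%:R != 0 :> R. Proof. by rewrite pnatr_eq0 -lt0n. Qed.
Let q_neq0 : #|predC P|%:R != 0 :> R. Proof. by rewrite pnatr_eq0 -lt0n. Qed.

Lemma sum_contrast0 : \sum_i contrast i = 0.
Proof. by rewrite (sum_contrast (fun=> id)) mulrN !divff// subrr. Qed.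

Lemma sum_norm_contrast : \sum_i `|contrast i| = 2.
Proof.
rewrite (sum_contrast (fun=> Num.norm)) normrN !ger0_norm ?invr_ge0//.
by rewrite !divff.
Qed.

Lemma sum_sqr_contrast :
  \sum_i contrast i ^+ 2 = #|I|%:R / (#|P|%:R * #|predC P|%:R).
Proof.
rewrite (sum_contrast (fun=> fun t => t ^+ 2)) -(cardC P) natrD.
by field; rewrite p_neq0 q_neq0.
Qed.

End Contrast.

(** * Splitting the indices into halves *)

Definition first_half (n : nat) : pred 'I_n := [pred i : 'I_n | (i < n./2)%N].

Lemma card_first_half n : #|@first_half n| = n./2.
Proof.
rewrite -sum1_card -(big_ord_widen n (fun=> 1%N)) ?sum1_card ?card_ord//.
by lia.
Qed.

Lemma card_first_halfC n : #|predC (@first_half n)| = uphalf n.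
Proof.
have := cardC (@first_half n); rewrite card_first_half card_ord => h.
apply: (@addnI n./2); apply: (etrans h); rewrite uphalf_half; lia.
Qed.

(** Follows from 4pq <= (p + q)^2: if p + q = 2h + 1, the right side is 4h(h + 1) + 1, and
    integrality removes the 1. *)
Lemma mul_le_half (p q : nat) : (p * q <= (p + q)./2 * uphalf (p + q))%N.
Proof.
have := (nat_AGM2 p q).1; have := odd_double_half (p + q).
by rewrite uphalf_half -mulnn; case: (odd _) => /= <-; nia.
Qed.

(** The two parities merge because 4 times the product of the halves is n^2 for even n and n^2 - 1
    for odd n. *)
Lemma variance_boundE (R : realType) (n : nat) : (0 < n)%N ->
  variance_bound R n =
    (n%:R - 1) * (4 * (n./2%:R * (uphalf n)%:R) / n%:R ^+ 2).
Proof.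
move=> n_gt0; have n_neq0 : n%:R != 0 :> R by rewrite pnatr_eq0 -lt0n.
have nE : n%:R = (odd n)%:R + n./2%:R * 2 :> R.
  by rewrite -natrM muln2 -natrD odd_double_half.
move: n_neq0; rewrite /variance_bound uphalf_half natrD nE.
case: (odd n) => /=; move: (n./2%:R) => h; rewrite ?mulr0n ?mulr1n ?add0r;
  move=> h_neq0; field=> //.
by move: h_neq0; rewrite mulf_eq0 negb_or => /andP[].
Qed.

Lemma first_half_gt0 n : (2 <= n)%N -> (0 < #|@first_half n|)%N.
Proof. by rewrite card_first_half half_gt0. Qed.

Lemma first_halfC_gt0 n : (2 <= n)%N -> (0 < #|predC (@first_half n)|)%N.
Proof. by move=> /ltnW n_gt0; rewrite card_first_halfC uphalf_gt0. Qed.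

(** * Inner products and norms *)

Section EuclideanSpace.
Context {R : realType} {E : vectType R} (dot : {dot E for idfun}).

Local Notation "''[' u , v ]" := (dot u%R v%R) : ring_scope.
Local Notation "''[' u ]" := (dot u%R u%R) : ring_scope.

Lemma dotC u v : '[u, v] = '[v, u].
Proof. by rewrite (hermC dot u v) expr0 mul1r. Qed.

Lemma dot_ge0 u : 0 <= '[u].
Proof.
have [->|u_neq0] := eqVneq u 0; first by rewrite linear0r.
exact/ltW/neq0_dnorm_gt0.
Qed.

Lemma enorm_ge0 u : 0 <= enorm dot u. Proof. exact: sqrtr_ge0. Qed.

Lemma sqr_enorm u : enorm dot u ^+ 2 = '[u].
Proof. by rewrite sqr_sqrtr// dot_ge0. Qed.

Lemma enorm_gt0 u : u != 0 -> 0 < enorm dot u.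
Proof. by move=> u_neq0; rewrite sqrtr_gt0 neq0_dnorm_gt0. Qed.

Lemma enorm_normalize u : u != 0 -> enorm dot ((enorm dot u)^-1 *: u) = 1.
Proof.
move=> /enorm_gt0 u_gt0; apply/eqP.
rewrite -(@eqrXn2 _ 2)// ?enorm_ge0// sqr_enorm linearZl_LR linearZr_LR/=.
rewrite -sqr_enorm expr1n /GRing.scale/=; apply/eqP.
by field; rewrite gt_eqF.
Qed.

Lemma dot_sum_l (I : finType) (c : I -> R) (z : I -> E) u :
  '[\sum_i c i *: z i, u] = \sum_i c i * '[z i, u].
Proof.
by rewrite linear_sumlz; apply: eq_bigr => i _; rewrite linearZl_LR.
Qed.

Lemma dot_sum_r (I : finType) (c : I -> R) (z : I -> E) u :
  '[u, \sum_i c i *: z i] = \sum_i c i * '[u, z i].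
Proof.
by rewrite linear_sumr; apply: eq_bigr => i _; rewrite linearZr_LR.
Qed.

Lemma dot_le_enorm w v : enorm dot w = 1 -> '[w, v] <= enorm dot v.
Proof.
move=> w1; have w2 : '[w] = 1 by rewrite -sqr_enorm w1 expr1n.
(* The part of [v] orthogonal to the unit vector [w] has squared norm |v|^2 - <w, v>^2. *)
have := dot_ge0 (v - '[w, v] *: w).
rewrite hnormB/= linearZl_LR !linearZr_LR/= w2 (dotC v w) => h.
apply: (le_trans (ler_norm _)).
rewrite -(ler_pXn2r (n := 2)) ?nnegrE ?enorm_ge0//.
rewrite sqr_enorm real_normK ?num_real//.
  by move: h; rewrite expr0 mul1r /GRing.scale/=; lra.
Qed.

(** * Lower bound on the variance of shattered points *)

Section Shattering.
Context {n : nat} (x : 'I_n -> E) (n_gt0 : (0 < n)%N).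

Lemma shatteredP b gamma : shattered dot x b gamma <->
  forall y : 'I_n -> R, (forall i, y i = -1 \/ y i = 1) ->
  exists2 w, enorm dot w = 1 &
    exists c, forall i, gamma <= ('[w, x i] - c - b i) * y i.
Proof.
split=> sh y /sh.
  move=> [_ [w w1 [c _ <-]]] /le_inf_range le_g; exists w => //.
  by exists c => i; exact: le_g.
move=> [w w1 [c le_g]]; exists (affine_function dot w c).
  by exists w => //; exists c.
by apply/le_inf_range.
Qed.

(* Replacing [l] by [- l] if necessary, the thresholds contribute with a
   favourable sign, and the offset cancels since [l] has zero sum. *)
Lemma shattered_sum_ge b gamma (l : 'I_n -> R) : \sum_i l i = 0 ->
  shattered dot x b gamma ->
  gamma * \sum_i `|l i| <= enorm dot (\sum_i l i *: x i).
Proof.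
move=> l0 /shatteredP sh.
wlog b_ge0 : l l0 / 0 <= \sum_i l i * b i => [hwlog|].
  have [|/ltW b_le0] := leP 0 (\sum_i l i * b i); first exact: hwlog.
  have := hwlog (fun i => - l i).
  under [\sum_i - l i * _]eq_bigr do rewrite mulNr.
  under [\sum_i _ *: _]eq_bigr do rewrite scaleNr.
  under [\sum_i `|_|]eq_bigr do rewrite normrN.
  by rewrite /enorm !sumrN hnormN l0 !oppr_ge0 oppr0; apply.
(* Labels follow the signs of [l], so each weighted value is at least [gamma] times the absolute
   weight. *)
have [|w w1 [c ge_g]] := sh (fun i => if 0 <= l i then 1 else -1).
  by move=> i; case: ifP; [right|left].
apply: le_trans (dot_le_enorm _ w1); rewrite dot_sum_r mulr_sumr.
have -> : \sum_i l i * '[w, x i] =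
    \sum_i l i * ('[w, x i] - c - b i) + c * \sum_i l i + \sum_i l i * b i.
  by rewrite mulr_sumr -!big_split/=; apply: eq_bigr => i _; ring.
rewrite l0 mulr0 addr0 -[leLHS]addr0 lerD//; apply: ler_sum => i _.
have := ge_g i; case: ifP => [l_ge0|/negbT].
  by rewrite (ger0_norm l_ge0) mulr1 mulrC; exact: ler_wpM2l.
rewrite -ltNge => l_lt0; rewrite (ltr0_norm l_lt0) mulrN1 => h.
nra.
Qed.

Local Notation centroid := (n%:R^-1 *: \sum_(j < n) x j).
Local Notation z i := (x i - centroid).

Lemma sum_centered : \sum_i z i = 0.
Proof.
rewrite sumrB sumr_const card_ord -scaler_nat scalerA divff ?scale1r ?subrr//.
by rewrite pnatr_eq0 -lt0n.
Qed.

(** The Gram matrix of the centred points, summed over all relabellings; by symmetry it has one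
    diagonal and one off-diagonal value. *)
Let T i j : R := \sum_(s : 'S_n) '[z (s i), z (s j)].

Let T_perm (t : 'S_n) i j : T (t i) (t j) = T i j.
Proof.
rewrite [RHS](reindex_inj (mulgI t)).
by apply: eq_bigr => s _; rewrite !permM.
Qed.

(** All diagonal entries agree, and each relabelling contributes the same trace, n times the
    variance. *)
Let T_diag i : T i i = n`!%:R * family_variance dot x.
Proof.
have TE : n%:R * T i i = \sum_j T j j.
  under eq_bigr => j _ do
    rewrite -(T_perm (tperm j i)) tpermL.
  by rewrite sumr_const card_ord mulr_natl.
have n_neq0 : n%:R != 0 :> R by rewrite pnatr_eq0 -lt0n.
apply: (mulfI n_neq0); rewrite TE exchange_big/=.
under eq_bigr => s _.
  rewrite (sum_perm s (fun j => '[z j])).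
  under eq_bigr do rewrite -sqr_enorm.
  over.
rewrite sumr_const card_Sn /family_variance mulrCA mulVKf//.
by rewrite mulr_natl.
Qed.

(** Each row of [T] sums to zero because the centred points do. *)
Let T_offdiag i j : i != j -> (n%:R - 1) * T i j = - T i i.
Proof.
move=> ij; apply/eqP; rewrite -addr_eq0 addrC; apply/eqP.
have -> : (n%:R - 1) * T i j = \sum_(k | k != i) T i k.
  rewrite (eq_bigr (fun=> T i j)) => [|k ki].
    by rewrite sumr_const cardC1 card_ord -[RHS]mulr_natl -subn1 natrB.
  by rewrite -(T_perm (tperm k j)) tpermL tpermD// eq_sym.
transitivity (\sum_k T i k); first by rewrite [RHS](bigD1 i).
rewrite exchange_big/= big1// => s _.
rewrite -linear_sumr (sum_perm s (fun j => z j)).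
by rewrite sum_centered linear0r.
Qed.

(** The squares expand into entries of [T]. Keeping n - 1 as a factor avoids a division and covers n
    = 1. *)
Lemma sum_perm_sqr_enorm (l : 'I_n -> R) : \sum_i l i = 0 ->
  (n%:R - 1) * \sum_(s : 'S_n) enorm dot (\sum_i l i *: x (s i)) ^+ 2 =
  n`!%:R * (n%:R * family_variance dot x * \sum_i l i ^+ 2).
Proof.
move=> l0.
have -> : \sum_(s : 'S_n) enorm dot (\sum_i l i *: x (s i)) ^+ 2 =
    \sum_i \sum_j l i * l j * T i j.
  under [RHS]eq_bigr => i _ do under eq_bigr => j _ do rewrite mulr_sumr.
  under [RHS]eq_bigr => i _ do rewrite exchange_big/=.
  rewrite [RHS]exchange_big/=; apply: eq_bigr => s _; rewrite sqr_enorm.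
  (* Weights of zero sum are blind to the translation by the centroid. *)
  have -> : \sum_i l i *: x (s i) = \sum_i l i *: z (s i).
    under [RHS]eq_bigr do rewrite scalerBr.
    by rewrite sumrB -scaler_suml l0 scale0r subr0.
  rewrite dot_sum_l; apply: eq_bigr => i _.
  by rewrite dot_sum_r mulr_sumr; apply: eq_bigr => j _; rewrite mulrA.
(* So [T] is proportional to n I - J with J the all-ones matrix; J then contributes the square of
   the sum of [l], which is 0. *)
have TE i j : (n%:R - 1) * T i j =
    n`!%:R * family_variance dot x * (n%:R * (i == j)%:R - 1).
  have [->|ij] := eqVneq i j; first by rewrite T_diag mulr1n; ring.
  by rewrite T_offdiag// T_diag mulr0n; ring.
transitivity (n`!%:R * family_variance dot x *
    \sum_i (n%:R * l i ^+ 2 - l i * \sum_j l j)).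
  rewrite !mulr_sumr; apply: eq_bigr => i _.
  have -> : l i ^+ 2 = \sum_j l i * l j * (i == j)%:R by
    rewrite (sumr_delta (fun j => l i * l j)) expr2.
  rewrite !mulr_sumr -sumrB mulr_sumr; apply: eq_bigr => j _.
  by rewrite mulrCA TE; ring.
under eq_bigr do rewrite l0 mulr0 subr0.
by rewrite -mulr_sumr; ring.
Qed.

Lemma shattered_variance_ge b (gamma : R) (l : 'I_n -> R) : \sum_i l i = 0 ->
  0 <= gamma -> shattered dot x b gamma ->
  (n%:R - 1) * (gamma * \sum_i `|l i|) ^+ 2 <=
    n%:R * family_variance dot x * \sum_i l i ^+ 2.
Proof.
move=> l0 gamma_ge0 sh.
have nfact_gt0 : 0 < n`!%:R :> R by rewrite ltr0n fact_gt0.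
rewrite -(ler_pM2l nfact_gt0) -sum_perm_sqr_enorm// mulrCA.
rewrite ler_wpM2l ?subr_ge0 ?ler1n//.
rewrite mulr_natl -(card_Sn n) -sumr_const; apply: ler_sum => s _.
rewrite ler_pXn2r ?nnegrE ?enorm_ge0//; last first.
  by rewrite mulr_ge0// sumr_ge0.
(* The permutation is moved from the points to the weights, as shattering is applied to [x] in its
   given order. *)
pose l' i := l ((s^-1)%g i).
have l'E i : l' (s i) = l i by rewrite /l' permK.
have -> : \sum_i l i *: x (s i) = \sum_i l' i *: x i.
  by rewrite -[RHS](sum_perm s); apply: eq_bigr => i _; rewrite l'E.
have -> : \sum_i `|l i| = \sum_i `|l' i|.
  by rewrite -[RHS](sum_perm s); apply: eq_bigr => i _; rewrite l'E.
apply: shattered_sum_ge sh; rewrite -(sum_perm s) -[RHS]l0.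
by apply: eq_bigr => i _; rewrite l'E.
Qed.

End Shattering.

(** * Convex hulls and their separation by halfspaces *)

Section Hull.
Context {n : nat} (x : 'I_n -> E) (n_gt0 : (0 < n)%N).

Lemma convex_set_mean (I : eqType) (C : set E) (s : seq I) (z : I -> E) :
  @convex_set R E C -> s != [::] -> (forall i, i \in s -> C (z i)) ->
  C ((size s)%:R^-1 *: \sum_(i <- s) z i).
Proof.
move=> convC; elim: s => [//|i s IHs] _ Cz.
have Ci : C (z i) by apply: Cz; rewrite mem_head.
have [->|s_neq0] := eqVneq s [::].
  by rewrite big_seq1 /= invr1 scale1r.
have Cs : C ((size s)%:R^-1 *: \sum_(j <- s) z j).
  by apply: IHs => // j js; apply: Cz; rewrite inE js orbT.
have m_neq0 : (size s)%:R != 0 :> R by rewrite pnatr_eq0 size_eq0.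
have m1_neq0 : 1 + (size s)%:R != 0 :> R by rewrite addrC natr1 pnatr_eq0.
have t_ge0 : 0 <= (size s).+1%:R^-1 :> R by rewrite invr_ge0.
have t_le1 : (size s).+1%:R^-1 <= 1 :> R by rewrite invf_le1 ?ltr0n// ler1n.
(* The new mean is the convex combination of the added point, with coefficient 1 / (size s + 1), and
   the old mean. *)
have := convC _ _ (Itv01 t_ge0 t_le1) (mem_set Ci) (mem_set Cs).
rewrite inE; congr C; rewrite big_cons/= scalerDr; congr (_ + _).
rewrite scalerA; congr (_ *: _).
rewrite -[LHS]/((1 - (size s).+1%:R^-1) / (size s)%:R) -nat1r.
by field; rewrite m1_neq0.
Qed.

Lemma convex_hull_mean (P : pred 'I_n) (A : set E) : (0 < #|P|)%N ->
  (forall i, P i -> A (x i)) ->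
  convex_hull A (#|P|%:R^-1 *: \sum_(i | P i) x i).
Proof.
move=> P_gt0 PA C [convC AC]; rewrite -big_enum cardE/=.
apply: convex_set_mean => //; first by rewrite -size_eq0 -cardE -lt0n.
by move=> i; rewrite mem_enum => /PA/AC.
Qed.

(** Taking [s] to be 1 or -1 covers both sides of a hyperplane. *)
Lemma convex_halfspace (w : E) (a : R) (s : R) :
  @convex_set R E [set u | a <= '[w, u] * s].
Proof.
move=> u v t; rewrite !inE /conv/= linearDr !linearZr_LR/= /unstable.onem.
move=> au av.
have t_ge0 : 0 <= t%:num by [].
have t_le1 : t%:num <= 1 by [].
rewrite /GRing.scale/=; nra.
Qed.

(** Label the points of [A] by 1 and all others by -1: the function obtained is at least [gamma] on
    the hull of [A] and at most [- gamma] on that of [B], and its direction has norm 1. *)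
Lemma hull_distances_ge gamma : shattered dot x (fun=> 0) gamma ->
  lbound (hull_distances dot x) (2 * gamma).
Proof.
move=> /(shatteredP _ n_gt0) sh _ [A [B [[Ax Bx [a Aa] [b Bb] AB] ->]]].
have [|w w1 [c ge_g]] := sh (fun i => if `[< A (x i) >] then 1 else -1).
  by move=> i; case: ifP; [right|left].
have hullA : convex_hull A `<=` [set u | gamma + c <= '[w, u] * 1].
  apply: smallest_sub; first exact: convex_halfspace.
  move=> _ /[dup] /Ax[i _ <-] Ai /=.
  by have := ge_g i; rewrite asboolT//; lra.
have hullB : convex_hull B `<=` [set u | gamma - c <= '[w, u] * -1].
  apply: smallest_sub; first exact: convex_halfspace.
  move=> _ /[dup] /Bx[i _ <-] Bi /=.
  have := ge_g i; rewrite asboolF; first lra.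
  by move=> Ai; have : (A `&` B) (x i) by []; rewrite AB.
apply: lb_le_inf.
  exists (enorm dot (a - b)), a; first exact: sub_gen_smallest.
  by exists b => //; exact: sub_gen_smallest.
move=> _ [u /hullA/= ge_u [v /hullB/= ge_v <-]].
apply: le_trans (dot_le_enorm _ w1); rewrite linearBr/=; lra.
Qed.

End Hull.

(** * Margin, variance and hull distances of a regular simplex *)

Section RegularSimplex.
Context {n : nat} (x : 'I_n -> E) (n_ge2 : (2 <= n)%N) (c : R).
Hypotheses (c_gt0 : 0 < c)
  (x_simplex : forall i j, '[x i - x j] = c * (i != j)%:R).

Let n_gt0 : (0 < n)%N. Proof. exact: ltnW. Qed.

(** Polarisation writes <x_k, x_i - x_j> through squared distances plus a term independent of k,
    which the zero sum kills. *)
Lemma simplex_dot_sum (l : 'I_n -> R) i j : \sum_k l k = 0 ->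
  '[\sum_k l k *: x k, x i - x j] = c / 2 * (l i - l j).
Proof.
move=> l0; rewrite dot_sum_l.
transitivity (\sum_k (c / 2 * (l k * (i == k)%:R - l k * (j == k)%:R)
                      + ('[x i] - '[x j]) / 2 * l k)).
  apply: eq_bigr => k _.
  have := x_simplex i k; have := x_simplex j k.
  rewrite !hnormB/= !expr0 !mul1r linearBr/=.
  rewrite (dotC (x k) (x i)) (dotC (x k) (x j)).
  case: eqVneq => _; case: eqVneq => _ /=; rewrite ?mulr0n ?mulr1n => hj hi;
    nra.
by rewrite big_split/= -!mulr_sumr l0 mulr0 addr0 sumrB !sumr_delta.
Qed.

Lemma simplex_sqr_enorm (l : 'I_n -> R) : \sum_k l k = 0 ->
  enorm dot (\sum_k l k *: x k) ^+ 2 = c / 2 * \sum_k l k ^+ 2.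
Proof.
move=> l0; pose j := Ordinal n_gt0; rewrite sqr_enorm.
(* Only one factor is rebased at [x j], giving differences to which [simplex_dot_sum] applies. *)
have {2}-> : \sum_k l k *: x k = \sum_k l k *: (x k - x j).
  under [RHS]eq_bigr do rewrite scalerBr.
  by rewrite sumrB -scaler_suml l0 scale0r subr0.
rewrite dot_sum_r.
transitivity (c / 2 * (\sum_k l k ^+ 2 - \sum_k l k * l j)).
  rewrite -sumrB mulr_sumr; apply: eq_bigr => k _.
  by rewrite simplex_dot_sum//; ring.
by rewrite -mulr_suml l0 mul0r subr0.
Qed.

Lemma simplex_variance : family_variance dot x = c * (n%:R - 1) / (2 * n%:R).
Proof.
have n_neq0 : n%:R != 0 :> R by rewrite pnatr_eq0 -lt0n.
rewrite /family_variance.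
have xE i : enorm dot (x i - n%:R^-1 *: \sum_(j < n) x j) ^+ 2 =
    c / 2 * (1 - n%:R^-1).
  (* A centred point is itself a combination with zero-sum weights, whose squares add up to 1 -
     1/n. *)
  have -> : x i - n%:R^-1 *: \sum_(j < n) x j =
      \sum_j ((i == j)%:R - n%:R^-1) *: x j.
    under [RHS]eq_bigr do rewrite scalerBl.
    rewrite sumrB -scaler_sumr [in RHS](bigD1 i)//= eqxx scale1r.
    rewrite [X in _ = _ + X - _]big1 ?addr0// => j.
    by rewrite eq_sym => /negbTE->; rewrite scale0r.
  have d1 : \sum_j (i == j)%:R = 1 :> R.
    by rewrite -[RHS](sumr_delta (fun=> 1) i); apply: eq_bigr => j _;
      rewrite mul1r.
  rewrite simplex_sqr_enorm.
    congr (_ * _).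
    transitivity (\sum_j ((1 - 2 / n%:R) * (i == j)%:R + n%:R^-1 ^+ 2 : R)).
      apply: eq_bigr => j _.
      by case: eqVneq => _ /=; rewrite ?mulr1n ?mulr0n; field.
    rewrite big_split/= -mulr_sumr d1 sumr_const card_ord -[_ *+ n]mulr_natl.
    by field.
  by rewrite sumrB d1 sumr_const card_ord -[_ *+ n]mulr_natl divff// subrr.
under eq_bigr do rewrite xE.
by rewrite sumr_const card_ord -[_ *+ n]mulr_natl; field.
Qed.

Definition mean_gap (P : pred 'I_n) : E := \sum_i contrast P i *: x i.

Lemma sqr_enorm_mean_gap P : (0 < #|P|)%N -> (0 < #|predC P|)%N ->
  enorm dot (mean_gap P) ^+ 2 =
    c / 2 * (n%:R / (#|P|%:R * #|predC P|%:R)).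
Proof.
move=> P_gt0 PC_gt0; rewrite simplex_sqr_enorm ?sum_contrast0//.
by rewrite sum_sqr_contrast ?card_ord.
Qed.

(** By [simplex_dot_sum], the normalised gap takes one value on the points of [P] and another on the
    rest, and these differ by the length of the gap. *)
Lemma mean_gap_shatters P : (0 < #|P|)%N -> (0 < #|predC P|)%N ->
  exists2 w, enorm dot w = 1 & exists a, forall i,
    '[w, x i] - a =
      if P i then enorm dot (mean_gap P) / 2
      else - (enorm dot (mean_gap P) / 2).
Proof.
move=> P_gt0 PC_gt0; set N := enorm dot (mean_gap P).
have N2 : N ^+ 2 = c / 2 * (#|P|%:R^-1 + #|predC P|%:R^-1).
  have nE : n%:R = #|P|%:R + #|predC P|%:R :> R.
    by rewrite -natrD (cardC P) card_ord.
  rewrite sqr_enorm_mean_gap// nE; field.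
  by rewrite !pnatr_eq0 -!lt0n PC_gt0.
have N_gt0 : 0 < N.
  rewrite lt_def enorm_ge0 andbT -sqrf_eq0 N2 mulf_neq0//.
    by rewrite gt_eqF// divr_gt0.
  by rewrite gt_eqF// addr_gt0// invr_gt0 ltr0n.
have /card_gt0P[i0] := P_gt0; rewrite unfold_in => Pi0.
have wE i : '[N^-1 *: mean_gap P, x i - x i0] = if P i then 0 else - N.
  rewrite linearZl_LR/= /GRing.scale/= simplex_dot_sum ?sum_contrast0//.
  rewrite /contrast Pi0; case: ifP => _; first by rewrite subrr !mulr0.
  have N_neq0 : N != 0 by rewrite gt_eqF.
  apply: (mulfI N_neq0); rewrite mulVKf//.
  by rewrite mulrN -expr2 N2; ring.
exists (N^-1 *: mean_gap P).
  rewrite enorm_normalize//; apply: contraTneq N_gt0 => gap0.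
  by rewrite /N gap0 /enorm linear0r sqrtr0 ltxx.
(* The offset lies midway between the two values. *)
exists ('[N^-1 *: mean_gap P, x i0] - N / 2) => i.
have := wE i; rewrite linearBr/=; case: ifP => _ h; lra.
Qed.

Local Notation gamma0 := (enorm dot (mean_gap (@first_half n)) / 2).

Let half_gt0 := first_half_gt0 n_ge2.
Let halfC_gt0 := first_halfC_gt0 n_ge2.

(** The squared gap is inversely proportional to the product of the two cardinals, which halves
    maximise. *)
Lemma mean_gap_min P : (0 < #|P|)%N -> (0 < #|predC P|)%N ->
  enorm dot (mean_gap (@first_half n)) <= enorm dot (mean_gap P).
Proof.
move=> P_gt0 PC_gt0; rewrite -(ler_pXn2r (n := 2)) ?nnegrE ?enorm_ge0//.
rewrite !sqr_enorm_mean_gap// ler_pM2l ?divr_gt0// ler_wpM2l//.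
rewrite lef_pV2 ?posrE ?mulr_gt0 ?ltr0n// -!natrM ler_nat.
rewrite card_first_half card_first_halfC.
by have := mul_le_half #|P| #|predC P|; rewrite cardC card_ord.
Qed.

Lemma simplex_margin_gt0 : 0 < gamma0.
Proof.
rewrite divr_gt0// lt_def enorm_ge0 andbT -sqrf_eq0 sqr_enorm_mean_gap//.
by rewrite gt_eqF// mulr_gt0 ?divr_gt0 ?mulr_gt0 ?ltr0n.
Qed.

Lemma simplex_shattered : shattered dot x (fun=> 0) gamma0.
Proof.
apply/(shatteredP _ n_gt0) => y y_sign.
pose P : pred 'I_n := [pred i | y i == 1].
(* Constant labels give no pair of centroids; any unit direction works with a large enough
   offset. *)
have y_const s : s = -1 \/ s = 1 -> (forall i, y i = s) ->
    exists2 w, enorm dot w = 1 &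
      exists a, forall i, gamma0 <= ('[w, x i] - a - 0) * y i.
  move=> s_sign ys; have [w w1 _] := mean_gap_shatters half_gt0 halfC_gt0.
  exists w => //; exists (- s * (gamma0 + \sum_j `|'[w, x j]|)) => i.
  have : `|'[w, x i]| <= \sum_j `|'[w, x j]|.
    by rewrite (bigD1 i)//= lerDl sumr_ge0.
  move: gamma0 => g; rewrite ler_norml ys => /andP[h1 h2].
  by case: s_sign => ->; lra.
have [P0|P_gt0] := posnP #|P|.
  apply: (y_const (-1)) => [|i]; first by left.
  have := card0_eq P0 i; rewrite !inE.
  by case: (y_sign i) => -> //; rewrite eqxx.
have [PC0|PC_gt0] := posnP #|predC P|.
  apply: (y_const 1) => [|i]; first by right.
  by have := card0_eq PC0 i; rewrite !inE => /negbFE/eqP.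
have [w w1 [a wE]] := mean_gap_shatters P_gt0 PC_gt0.
exists w => //; exists a => i; rewrite subr0 wE /P/=.
have := mean_gap_min P_gt0 PC_gt0.
have [->|yi] := eqVneq (y i) 1; first by lra.
by case: (y_sign i) yi => ->; [lra|rewrite eqxx].
Qed.

(** Optimality comes from [shattered_sum_ge] with the contrast of the halves, whose absolute values
    sum to 2. *)
Lemma simplex_optimal_margin : optimal_margin dot x (fun=> 0) gamma0.
Proof.
split=> [|gamma sh]; first exact: simplex_shattered.
rewrite ler_pdivlMr// -(sum_norm_contrast half_gt0 halfC_gt0).
by apply: shattered_sum_ge sh => //; rewrite sum_contrast0.
Qed.

Lemma simplex_variance_margin :
  family_variance dot x / gamma0 ^+ 2 = variance_bound R n.
Proof.
have n_neq0 : n%:R != 0 :> R by rewrite pnatr_eq0 -lt0n.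
rewrite simplex_variance variance_boundE// expr_div_n sqr_enorm_mean_gap//.
rewrite -card_first_half -card_first_halfC; field.
by rewrite n_neq0 !pnatr_eq0 -!lt0n halfC_gt0 half_gt0 gt_eqF.
Qed.

(** The minimum is attained by the two halves: their centroids lie in the hulls, at distance exactly
    twice the margin. *)
Lemma simplex_hull_distances :
  injective x -> is_minimum (hull_distances dot x) (2 * gamma0).
Proof.
move=> x_inj; have lb := hull_distances_ge n_gt0 simplex_shattered.
pose A := x @` [set i | first_half i]; pose B := x @` [set i | ~~ first_half i].
pose d := set_distance dot (convex_hull A) (convex_hull B).
have d_dist : hull_distances dot x d.
  exists A, B; split=> //; split.
  - by move=> _ [i _ <-]; exists i.
  - by move=> _ [i _ <-]; exists i.
  - by have /card_gt0P[i] := half_gt0; exists (x i), i.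
  - by have /card_gt0P[i] := halfC_gt0; exists (x i), i.
  - rewrite -subset0 => _ [[i Pi <-] [j /negP Pj /x_inj ji]].
    by rewrite ji in Pj.
split=> //; suff -> : 2 * gamma0 = d by [].
apply/le_anti; rewrite lb//=; apply: ge_inf.
  by exists 0 => _ [u _ [v _ <-]]; exact: enorm_ge0.
exists (#|@first_half n|%:R^-1 *: \sum_(i | first_half i) x i).
  by apply: convex_hull_mean => // i Pi; exists i.
exists (#|predC (@first_half n)|%:R^-1 *: \sum_(i | ~~ first_half i) x i).
  by apply: convex_hull_mean => // i Pi; exists i.
rewrite mulrC divfK//; congr enorm.
rewrite /mean_gap [RHS](bigID (@first_half n))/= !scaler_sumr -sumrN.
congr (_ + _); apply: eq_bigr => i; rewrite /contrast.
  by move=> Pi; rewrite [first_half i]Pi.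
by move=> /negbTE Pi; rewrite [first_half i]Pi scaleNr.
Qed.

End RegularSimplex.
End EuclideanSpace.

(** * The variance bound and the equality case *)

Theorem theorem4p2p4 (R : realType) (E : vectType R) (dot : {dot E for idfun})
    (n : nat) (n_ge2 : (2 <= n)%N) (x : 'I_n -> E) :
  (forall gamma : R, 0 < gamma ->
     (exists b : 'I_n -> R, shattered dot x b gamma) ->
     variance_bound R n <= family_variance dot x / gamma ^+ 2) /\
  (regular_simplex dot x ->
     (exists2 gamma : R, 0 < gamma & optimal_margin dot x (fun=> 0) gamma) /\
     (forall gamma : R, 0 < gamma ->
        (optimal_margin dot x (fun=> 0) gamma <->
           is_minimum (hull_distances dot x) (2 * gamma)) /\
        (optimal_margin dot x (fun=> 0) gamma ->
           family_variance dot x / gamma ^+ 2 = variance_bound R n))).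
Proof.
have n_gt0 : (0 < n)%N by exact: ltnW.
have half_gt0 := first_half_gt0 n_ge2.
have halfC_gt0 := first_halfC_gt0 n_ge2.
split=> [gamma gamma_gt0 [b sh]|[x_inj x_eq]].
  have := shattered_variance_ge n_gt0 (sum_contrast0 half_gt0 halfC_gt0)
    (ltW gamma_gt0) sh.
  rewrite sum_norm_contrast// sum_sqr_contrast// card_ord.
  rewrite variance_boundE// -card_first_half -card_first_halfC.
  have n_gt0R : 0 < n%:R :> R by rewrite ltr0n.
  have : 0 < #|@first_half n|%:R :> R by rewrite ltr0n.
  have : 0 < #|predC (@first_half n)|%:R :> R by rewrite ltr0n.
  move: (#|_|%:R) (#|_|%:R) => q p q_gt0 p_gt0 h.
  rewrite ler_pdivlMr ?exprn_gt0//.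
  have pqn_ge0 : 0 <= p * q / n%:R ^+ 2.
    by rewrite divr_ge0 ?mulr_ge0 ?exprn_ge0 ?ltW.
  (* The factor pq / n^2 clears the sum of squared weights n / (pq). *)
  have := ler_wpM2r pqn_ge0 h; congr (_ <= _); first by field; rewrite gt_eqF.
  by field; rewrite !gt_eqF.
(* The squared side is read off the first two points, distinct by injectivity. *)
pose i0 : 'I_n := Ordinal n_gt0; pose i1 : 'I_n := Ordinal n_ge2.
have c_gt0 : 0 < dot (x i0 - x i1) (x i0 - x i1).
  by rewrite neq0_dnorm_gt0// subr_eq0 (inj_eq x_inj).
have x_simplex i j :
    dot (x i - x j) (x i - x j) = dot (x i0 - x i1) (x i0 - x i1) * (i != j)%:R.
  have [->|ij] := eqVneq i j; first by rewrite subrr linear0r mulr0.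
  by rewrite mulr1 -!sqr_enorm (x_eq i j i0 i1).
have gamma0_gt0 := simplex_margin_gt0 n_ge2 c_gt0 x_simplex.
have opt := simplex_optimal_margin n_ge2 c_gt0 x_simplex.
have min := simplex_hull_distances n_ge2 c_gt0 x_simplex x_inj.
have var := simplex_variance_margin n_ge2 c_gt0 x_simplex.
move: (_ / 2) gamma0_gt0 opt min var => gamma0 gamma0_gt0 opt min var.
(* An optimal margin is unique, and so is a minimum; hence both conditions on [gamma] amount to
   [gamma = gamma0]. *)
have opt_uniq gamma : optimal_margin dot x (fun=> 0) gamma -> gamma = gamma0.
  move=> [sh ub]; apply/le_anti.
  by rewrite (ub _ opt.1) (opt.2 _ sh).
split=> [|gamma gamma_gt0]; first by exists gamma0.
split=> [|/opt_uniq->//]; split=> [/opt_uniq->//|[d_gamma lb]].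
suff -> : gamma = gamma0 by [].
have le1 := lb _ min.1; have le2 := min.2 _ d_gamma.
by apply/le_anti; apply/andP; split; lra.
Qed.
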